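(* Assume that $g$ is Lipschitz-continuous with a constant $\ell_g>0$ and that the stabilization parameter satisfies $\kappa\ge2\ell_g$. Let $\tau>0$. Consider the two schemes, for $n\ge1$: (TIF1) $\ u_h^n=(I+\tau L_\kappa)^{-1}u_h^{n-1}+\tau(I+\tau L_\kappa)^{-1}g_\kappa(u_h^{n-1})$; (NIF1) $\ u_h^n=u_h^{n-1}+(\tau L_\kappa)^{-1}(I-e^{-\tau L_\kappa})\big[\tau g_\kappa(u_h^{n-1})-\tau L_\kappa u_h^{n-1}\big]$. Both schemes preserve the original energy dissipation law in the sense that $$E[u_h^n]-E[u_h^{n-1}]\le-\frac1\tau\big\langle\delta_\tau u_h^n,\ D^{(1)}(-\tau L_\kappa)\,\delta_\tau u_h^n\big\rangle\qquad\text{for } n\ge1,$$ where $\delta_\tau u_h^n:=u_h^n-u_h^{n-1}$, and $D^{(1)}=D^{(1)}_{\mathrm T}$ for TIF1 and $D^{(1)}=D^{(1)}_{\mathrm N}$ for NIF1, with $$D^{(1)}_{\mathrm T}(z)=1-\frac z2,\qquad D^{(1)}_{\mathrm N}(z)=\frac{z}{e^z-1}+\frac z2 .$$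
   Context: Setting: $L_h$ is a symmetric positive definite real $M\times M$ matrix (a spatial discretization of a stiff linear operator). $G$ is a non-negative differentiable (Lyapunov) function and $g(v)=-\frac{\delta}{\delta v}G(v)$, i.e. $g=-G'$; both $G$ and $g$ act componentwise on vectors in $\mathbb{R}^M$. The inner product is $\langle u,v\rangle:=v^Tu$. The original energy is $E[u]:=\frac12\langle u,L_hu\rangle+\langle G(u),1\rangle$, where $1$ denotes the all-ones vector; the problem $u_h'(t)+L_hu_h(t)=g(u_h(t))$ is the gradient flow $\frac{du_h}{dt}=-\frac{\delta E}{\delta u_h}$, whose original energy dissipation law is $\frac{dE}{dt}=-\langle\frac{du_h}{dt},\frac{du_h}{dt}\rangle\le0$. For $\kappa\ge0$ put $L_\kappa:=L_h+\kappa I$ and $g_\kappa(u):=\kappa u+g(u)$. Functions $f(-\tau L_\kappa)$ are matrix functions of the symmetric matrix $-\tau L_\kappa$ (whose spectrum lies in $(-\infty,0)$), defined via its spectral decomposition. *)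

(* Defs.v *)
From mathcomp Require Import all_boot all_order all_algebra.
From mathcomp Require Import all_classical all_reals all_analysis.
From mathcomp Require complex.
From mathcomp Require Import ring.

Set Implicit Arguments.
Unset Strict Implicit.
Unset Printing Implicit Defensive.

Import Order.TTheory GRing.Theory Num.Theory.
Import numFieldNormedType.Exports.

Local Open Scope ring_scope.

Definition dotv (R : realType) (n : nat) (u v : 'cV[R]_n) : R :=
  (v^T *m u) 0 0.

Definition spdmx (R : realType) (n : nat) (A : 'M[R]_n) : Prop :=
  A^T = A /\ forall v : 'cV[R]_n, v != 0 -> 0 < dotv v (A *m v).

(* (P, d) is an orthogonal diagonalization A = P^T diag(d) P. *)
Definition spectral_decomp (R : realType) (n : nat) (A : 'M[R]_n)
    (Pd : 'M[R]_n * 'rV[R]_n) : Prop :=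
  Pd.1 *m Pd.1^T = 1%:M /\ A = Pd.1^T *m diag_mx Pd.2 *m Pd.1.

(* f(A) = P^T diag(f(d)) P for a chosen spectral decomposition (P, d) of A.
   By [symmetric_spectral_decomp] and [mxfunE] below, a decomposition exists
   whenever A is symmetric, and the value does not depend on the choice.  For a
   non-symmetric A the value is junk. *)
Definition mxfun (R : realType) (n : nat) (f : R -> R) (A : 'M[R]_n) : 'M[R]_n :=
  let Pd := xget (1%:M, 0) [set Pd | spectral_decomp A Pd]%classic in
  Pd.1^T *m diag_mx (map_mx f Pd.2) *m Pd.1.

(* [map_mx G] is the componentwise action of the scalar function G. *)
Definition energy (R : realType) (n : nat) (L : 'M[R]_n) (G : R -> R)
    (u : 'cV[R]_n) : R :=
  2^-1 * dotv u (L *m u) + dotv (map_mx G u) (const_mx 1).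

Definition stabL (R : realType) (n : nat) (kappa : R) (L : 'M[R]_n) : 'M[R]_n :=
  L + kappa%:M.

Definition stabg (R : realType) (n : nat) (kappa : R) (g : R -> R)
    (u : 'cV[R]_n) : 'cV[R]_n :=
  kappa *: u + map_mx g u.

Definition tif1_step (R : realType) (n : nat) (tau kappa : R) (L : 'M[R]_n)
    (g : R -> R) (u : 'cV[R]_n) : 'cV[R]_n :=
  let Lk := stabL kappa L in
  invmx (1%:M + tau *: Lk) *m u
  + tau *: (invmx (1%:M + tau *: Lk) *m stabg kappa g u).

Definition nif1_step (R : realType) (n : nat) (tau kappa : R) (L : 'M[R]_n)
    (g : R -> R) (u : 'cV[R]_n) : 'cV[R]_n :=
  let Lk := stabL kappa L in
  u + invmx (tau *: Lk) *m (1%:M - mxfun expR (- (tau *: Lk)))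
      *m (tau *: stabg kappa g u - tau *: (Lk *m u)).

Definition DT1 (R : realType) (z : R) : R := 1 - z / 2.

(* At z = 0 the quotient is 0 / 0 = 0 here rather than its limit 1; only
   negative z (the spectrum of - tau L_kappa) matter. *)
Definition DN1 (R : realType) (z : R) : R := z / (expR z - 1) + z / 2.

Lemma mxfunE (R : realType) (n : nat) (f : R -> R) (A P : 'M[R]_n)
    (d : 'rV[R]_n) :
  spectral_decomp A (P, d) -> mxfun f A = P^T *m diag_mx (map_mx f d) *m P.
Proof.
move=> Pd; rewrite /mxfun.
have := @xgetI _ (1%:M, 0) [set Pd | spectral_decomp A Pd]%classic _ Pd.
case: (xget _ _) => Q e /= [/= QQ AQ]; case: Pd => /= PP AP.
have PP' : P^T *m P = 1%:M by rewrite (mulmx1C PP).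
have QQ' : Q^T *m Q = 1%:M by rewrite (mulmx1C QQ).
pose W := P *m Q^T.
have WE : diag_mx d *m W = W *m diag_mx e.
  transitivity (P *m A *m Q^T).
    by rewrite AP /W !mulmxA PP mul1mx.
  by rewrite AQ /W !mulmxA -[_ *m Q *m Q^T]mulmxA QQ mulmx1.
have WfE : diag_mx (map_mx f d) *m W = W *m diag_mx (map_mx f e).
  apply/matrixP => i j; move/matrixP/(_ i j): WE.
  rewrite !mul_diag_mx !mul_mx_diag !mxE => WE.
  have [->|W0] := eqVneq (\sum_j0 P i j0 * Q^T j0 j) 0; first by rewrite mulr0 mul0r.
  rewrite [RHS]mulrC; congr (f _ * _).
  by apply: (mulIf W0); rewrite WE mulrC.
rewrite -[LHS]mul1mx -PP' -!mulmxA; congr (_ *m _).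
rewrite -[RHS]mulmx1 -QQ' !mulmxA; congr (_ *m _).
by rewrite -[RHS]mulmxA WfE.
Qed.

Section Spectral.
Import mathcomp.real_closed.complex.

Lemma real_eigenvector (R : realType) (n : nat) (A : 'M[R]_n.+1) :
  A^T = A -> exists2 u : 'rV[R]_n.+1, u *m u^T = 1%:M &
                                       exists a, u *m A = a *: u.
Proof.
move=> sA.
pose iC := real_complex R.
have [z] := @eigenvalue_closed (complex R) n.+1 (map_mx iC A) isT.
move=> ez; have /eigenvalueP [v vA v0] := ez.
have herm : forall w : 'rV[complex R]_n.+1, w *m map_mx Num.conj w^T = 0 -> w = 0.
  move=> w /matrixP/(_ 0 0); rewrite !mxE => ws.
  apply/rowP => i; rewrite mxE.
  have /psumr_eq0P : \sum_j w 0 j * (map_mx Num.conj w^T) j 0 = 0 by [].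
  move=> /(_ _ i isT); rewrite !mxE => h.
  have : w 0 i * (w 0 i)^* = 0.
    by apply: h => j _; rewrite !mxE mul_conjC_ge0.
  by move/eqP; rewrite mul_conjC_eq0 => /eqP.
have zr : z \is Num.real.
  have cA : map_mx Num.conj (map_mx iC A) = map_mx iC A.
    apply/matrixP => i j; rewrite !mxE; apply/CrealP.
    by rewrite complex_real.
  have E1 : v *m map_mx iC A *m map_mx Num.conj v^T = z *: (v *m map_mx Num.conj v^T).
    by rewrite vA scalemxAl.
  have E2 : v *m map_mx iC A *m map_mx Num.conj v^T = z^* *: (v *m map_mx Num.conj v^T).
    rewrite -mulmxA -cA -map_mxM -{1}sA -map_trmx -trmx_mul vA.
    by rewrite linearZ /= map_mxZ scalemxAr.
  have : (z - z^*) *: (v *m map_mx Num.conj v^T) = 0 by rewrite scalerBl -E1 -E2 subrr.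
  move/eqP; rewrite scaler_eq0 => /orP[|/eqP/herm v00]; last by rewrite v00 eqxx in v0.
  by rewrite subr_eq0 => /eqP zz; apply/CrealP.
have [x zx] : exists x, z = iC x by case/complex_realP: zr => x ->; exists x.
move: ez; rewrite zx eigenvalue_map => /eigenvalueP [w wA w0].
pose s : R := \sum_j w 0 j ^+ 2.
have ws : w *m w^T = s%:M.
  by apply/matrixP => i j; rewrite !ord1 !mxE eqxx mulr1n; apply: eq_bigr => k _;
     rewrite mxE expr2.
have s0 : 0 < s.
  rewrite lt0r sumr_ge0 ?andbT => [|j _]; last exact: sqr_ge0.
  apply: contraNneq w0 => /psumr_eq0P h; apply/eqP/rowP => j; rewrite mxE.
  by apply/eqP; rewrite -sqrf_eq0; apply/eqP/h => // k _; apply: sqr_ge0.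
exists ((Num.sqrt s)^-1 *: w); last by exists x; rewrite -scalemxAl wA !scalerA mulrC.
rewrite linearZ /= -scalemxAl -scalemxAr scalerA ws -expr2 exprVn sqr_sqrtr ?ltW//.
by rewrite scale_scalar_mx mulVf ?gt_eqF.
Qed.

End Spectral.

Lemma row_mul_tr_eq0 (R : realType) (n : nat) (w : 'rV[R]_n) :
  w *m w^T = 0 -> w = 0.
Proof.
move=> /matrixP/(_ 0 0); rewrite [LHS]mxE [RHS]mxE => h.
have h' : \sum_k w 0 k ^+ 2 = 0.
  by rewrite -[RHS]h; apply: eq_bigr => k _; rewrite mxE expr2.
apply/rowP => j; rewrite mxE; apply/eqP; rewrite -sqrf_eq0; apply/eqP.
by move/psumr_eq0P: h'; apply => // k _; apply: sqr_ge0.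
Qed.

(* Householder reflection: an orthogonal symmetric matrix with first row u. *)
Lemma unit_row_orthogonal (R : realType) (n : nat) (u : 'rV[R]_n.+1) :
  u *m u^T = 1%:M ->
  exists H : 'M[R]_n.+1, [/\ H^T = H, H *m H = 1%:M & row 0 H = u].
Proof.
move=> uu.
have [->|ne] := eqVneq u (delta_mx 0 0).
  by exists 1%:M; rewrite trmx1 mul1mx rowE mulmx1.
pose e : 'rV[R]_n.+1 := delta_mx 0 0.
have ee : e *m e^T = 1%:M.
  apply/matrixP => i j; rewrite !ord1 !mxE (bigD1 0)//= big1 => [|k k0].
    by rewrite !mxE !eqxx mulr1 addr0.
  by rewrite !mxE (negbTE k0) mul0r.
pose w := e - u.
pose c := u 0 0.
have eu : e *m u^T = c%:M.
  by apply/matrixP => i j; rewrite !ord1 -rowE !mxE eqxx.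
have ue : u *m e^T = c%:M by rewrite -[LHS]trmxK trmx_mul trmxK eu tr_scalar_mx.
have ww : w *m w^T = (2 - 2 * c)%:M.
  rewrite /w linearB /= mulmxBl !mulmxBr ee eu ue uu.
  by apply/matrixP => i j; rewrite !ord1 !mxE !eqxx !mulr1n; ring.
have w0 : 2 - 2 * c != 0.
  apply: contraNneq ne => c0; rewrite -subr_eq0 -oppr_eq0 opprB -/e -/w.
  by apply/eqP/row_mul_tr_eq0; rewrite ww c0 raddf0.
have ew : e *m w^T = (1 - c)%:M.
  by rewrite /w linearB /= mulmxBr ee eu -raddfB.
pose a := 2 / (2 - 2 * c).
exists (1%:M - a *: (w^T *m w)); split.
- by rewrite linearB /= trmx1 linearZ /= trmx_mul trmxK.
- have WW : w^T *m w *m (w^T *m w) = (2 - 2 * c) *: (w^T *m w).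
    by rewrite mulmxA -[w^T *m w *m _]mulmxA ww mul_mx_scalar scalemxAl.
  rewrite mulmxBl mul1mx [X in _ - X]mulmxBr mulmx1 -[X in _ - (_ - X)]scalemxAl.
  rewrite -scalemxAr WW !scalerA opprB -[RHS]addr0 -addrA.
  congr (_ + _); rewrite -(scaleNr a (w^T *m w)) -!scalerDl (_ : _ + (_ + _) = 0 :> R) ?scale0r//.
  by rewrite /a; field.
- rewrite rowE -/e mulmxBr mulmx1 -scalemxAr mulmxA ew mul_scalar_mx scalerA.
  have -> : a * (1 - c) = 1 by rewrite /a; field.
  by rewrite scale1r /w opprB addrC subrK.
Qed.

Lemma symmetric_spectral_decomp (R : realType) (n : nat) (A : 'M[R]_n) :
  A^T = A -> exists Pd, spectral_decomp A Pd.
Proof.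
elim: n A => [|n IH] A sA.
  by exists (0, 0); split; apply/matrixP => -[].
have [u uu [a uA]] := real_eigenvector sA.
have [H [sH HH rH]] := unit_row_orthogonal uu.
pose B : 'M[R]_(1 + n) := H *m A *m H.
have sB : B^T = B by rewrite /B !trmx_mul sA sH mulmxA.
have r0B : row 0 B = a *: delta_mx 0 0.
  rewrite /B -mulmxA row_mul rH mulmxA uA -scalemxAl; congr (_ *: _).
  by rewrite -rH -row_mul HH rowE mulmx1.
have B00 : B 0 0 = a by move/rowP/(_ 0): r0B; rewrite !mxE !eqxx mulr1.
have B0j (j : 'I_n) : B 0 (lift 0 j) = 0.
  by move/rowP/(_ (lift 0 j)): r0B; rewrite !mxE mulr0.
have Bj0 (j : 'I_n) : B (lift 0 j) 0 = 0.
  by rewrite -sB mxE B0j.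
have AE : A = H *m B *m H by rewrite /B !mulmxA HH mul1mx -mulmxA HH mulmx1.
clearbody B.
have sC : (drsubmx B)^T = drsubmx B by rewrite trmx_drsub sB.
have [[Q d] [/= QQ QE]] := IH _ sC.
have BE : B = block_mx a%:M 0 0 (drsubmx B).
  rewrite -[LHS]submxK; congr block_mx.
  - by apply/matrixP => i j; rewrite !ord1 !mxE -B00 mulr1n; congr (B _ _); apply/val_inj.
  - by apply/matrixP => i j; rewrite !ord1 !mxE -(B0j j); congr (B _ _); apply/val_inj.
  - by apply/matrixP => i j; rewrite !ord1 !mxE -(Bj0 i); congr (B _ _); apply/val_inj.
pose K : 'M[R]_(1 + n) := block_mx 1%:M 0 0 Q.
have KT : K^T = block_mx 1%:M 0 0 Q^T by rewrite tr_block_mx !trmx0 trmx1.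
have KK : K *m K^T = 1%:M.
  rewrite KT mulmx_block !(mul0mx, mulmx0, mul1mx, addr0, add0r) QQ.
  by rewrite -scalar_mx_block.
have KB : K^T *m diag_mx (row_mx a%:M d) *m K = B.
  rewrite KT diag_mx_row !mulmx_block.
  rewrite !(mul0mx, mulmx0, mul1mx, mulmx1, addr0, add0r) -QE BE block_mxKdr.
  by congr block_mx; apply/matrixP => i j; rewrite !ord1 !mxE.
exists (K *m H, row_mx a%:M d); split => /=.
  by rewrite trmx_mul sH mulmxA -[K *m H *m H]mulmxA HH mulmx1.
by rewrite trmx_mul sH {1}AE -KB !mulmxA.
Qed.

(* Main.v *)
(** Since [g] is Lipschitz, the mean value theorem gives
    [G(y) - G(x) <= - g(x)(y - x) + lg (y - x)^2], and [lg <= kappa / 2] lets the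
    quadratic remainder be absorbed in the stabilization: for all [u], [w] with
    [d = w - u],
      [E[w] - E[u] <= - <d, g_kappa(u) - L_kappa u> + <d, L_kappa d> / 2].
    Each scheme, solved for the residual, reads
    [tau (g_kappa(u) - L_kappa u) = B d], where with [Z = - tau L_kappa] one has
    [B = I - Z] (TIF1) or [B = Z (e^Z - I)^-1] (NIF1).  The right-hand side is then
    [- <d, (B + Z / 2) d> / tau], and [B + Z / 2 = D(Z)] by functional calculus. *)

Require Import Defs.
From mathcomp Require Import all_boot all_order all_algebra.
From mathcomp Require Import all_classical all_reals all_analysis.
From mathcomp Require Import ring lra.
Import Order.TTheory GRing.Theory Num.Theory.
Import numFieldNormedType.Exports.
Local Open Scope ring_scope.

(** * Bilinearity and symmetry of the inner product *)

Lemma dotvE {R : realType} {n : nat} (u v : 'cV[R]_n) :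
  dotv u v = \sum_i u i 0 * v i 0.
Proof. by rewrite /dotv mxE; apply: eq_bigr => i _; rewrite mxE mulrC. Qed.

Lemma dotvDr {R : realType} {n : nat} (u v w : 'cV[R]_n) :
  dotv u (v + w) = dotv u v + dotv u w.
Proof. by rewrite /dotv linearD /= mulmxDl mxE. Qed.

Lemma dotvZr {R : realType} {n : nat} (a : R) (u v : 'cV[R]_n) :
  dotv u (a *: v) = a * dotv u v.
Proof. by rewrite /dotv linearZ /= -scalemxAl mxE. Qed.

Lemma dotvNr {R : realType} {n : nat} (u v : 'cV[R]_n) :
  dotv u (- v) = - dotv u v.
Proof. by rewrite /dotv linearN /= mulNmx mxE. Qed.

Lemma dotvC {R : realType} {n : nat} (u v : 'cV[R]_n) : dotv u v = dotv v u.
Proof. by rewrite !dotvE; apply: eq_bigr => i _; rewrite mulrC. Qed.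

Lemma dotvDl {R : realType} {n : nat} (u v w : 'cV[R]_n) :
  dotv (u + v) w = dotv u w + dotv v w.
Proof. by rewrite dotvC dotvDr !(dotvC w). Qed.

Lemma dotv_sym {R : realType} {n : nat} {A : 'M[R]_n} (u v : 'cV[R]_n) :
  A^T = A -> dotv u (A *m v) = dotv v (A *m u).
Proof. by move=> sA; rewrite [RHS]dotvC /dotv trmx_mul sA mulmxA. Qed.

Lemma dotv_ge0 {R : realType} {n : nat} (u : 'cV[R]_n) : 0 <= dotv u u.
Proof. by rewrite dotvE sumr_ge0// => i _; rewrite -expr2 sqr_ge0. Qed.

(** * Functional calculus of a symmetric matrix, computed in one common decomposition *)

Lemma mxfunM {R : realType} {n : nat} {A : 'M[R]_n} (f g : R -> R) :
  A^T = A -> mxfun f A *m mxfun g A = mxfun (fun x => f x * g x) A.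
Proof.
move=> /symmetric_spectral_decomp[[P d] PdA].
rewrite !(mxfunE _ PdA); case: PdA => /= PP _.
rewrite !mulmxA -[_ *m P *m P^T]mulmxA PP mulmx1; congr (_ *m _).
rewrite -mulmxA mulmx_diag; congr (_ *m diag_mx _).
by apply/rowP => i; rewrite !mxE.
Qed.

Lemma mxfunD {R : realType} {n : nat} {A : 'M[R]_n} (f g : R -> R) :
  A^T = A -> mxfun f A + mxfun g A = mxfun (fun x => f x + g x) A.
Proof.
move=> /symmetric_spectral_decomp[[P d] PdA].
rewrite !(mxfunE _ PdA) -mulmxDl -mulmxDr -raddfD.
by congr (_ *m diag_mx _ *m _); apply/rowP => i; rewrite !mxE.
Qed.

Lemma mxfun_cst {R : realType} {n : nat} {A : 'M[R]_n} (c : R) :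
  A^T = A -> mxfun (fun=> c) A = c%:M.
Proof.
move=> /symmetric_spectral_decomp[[P d] PdA].
rewrite (mxfunE _ PdA); case: PdA => /= PP _.
have -> : map_mx (fun=> c) d = const_mx c by apply/rowP => i; rewrite !mxE.
by rewrite diag_const_mx mul_mx_scalar -scalemxAl (mulmx1C PP) scalemx1.
Qed.

Lemma mxfun_id {R : realType} {n : nat} {A : 'M[R]_n} : A^T = A -> mxfun id A = A.
Proof.
move=> /symmetric_spectral_decomp[[P d] PdA].
by rewrite (mxfunE _ PdA) map_mx_id; case: PdA.
Qed.

Lemma mxfunZ {R : realType} {n : nat} {A : 'M[R]_n} (c : R) (f : R -> R) :
  A^T = A -> c *: mxfun f A = mxfun (fun x => c * f x) A.
Proof. by move=> sA; rewrite -mul_scalar_mx -(mxfun_cst c sA) mxfunM. Qed.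

(** Each entry of [d] is the quadratic form of [A] at an eigenvector, a column of [P^T], hence
    negative. Values such as a quotient by zero at [x = 0] therefore never enter. *)
Lemma eq_mxfun_neg {R : realType} {n : nat} {A : 'M[R]_n} {f g : R -> R} :
  A^T = A -> (forall v : 'cV[R]_n, v != 0 -> dotv v (A *m v) < 0) ->
  (forall x, x < 0 -> f x = g x) -> mxfun f A = mxfun g A.
Proof.
move=> sA negA fg; have [[P d] PdA] := symmetric_spectral_decomp sA.
rewrite !(mxfunE _ PdA); case: PdA => /= PP AE.
congr (_ *m diag_mx _ *m _); apply/rowP => i; rewrite !mxE; apply: fg.
pose v : 'cV[R]_n := P^T *m delta_mx i 0.
have Pv : P *m v = delta_mx i 0 by rewrite /v mulmxA PP mul1mx.
have v0 : v != 0.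
  apply/eqP => v0; move/matrixP/(_ i 0): Pv; rewrite v0 mulmx0 !mxE !eqxx /=.
  by move/eqP; rewrite eq_sym oner_eq0.
have := negA v v0.
rewrite dotvC AE /dotv -!mulmxA Pv mulmxA -[v^T *m P^T]trmx_mul Pv trmx_delta.
by rewrite -rowE mxE mul_diag_mx !mxE !eqxx mulr1.
Qed.

(** A nonzero kernel vector would make the quadratic form vanish. *)
Lemma posdef_unitmx {R : realType} {n : nat} (A : 'M[R]_n) :
  (forall v : 'cV[R]_n, v != 0 -> 0 < dotv v (A *m v)) -> A \in unitmx.
Proof.
move=> posA; rewrite -unitmx_tr -row_free_unit; apply: inj_row_free => v vA.
apply/eqP; rewrite -trmx_eq0; apply: contraTT isT => /posA.
by rewrite -[A *m _]trmxK trmx_mul trmxK vA /dotv !trmx0 mul0mx mxE ltxx.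
Qed.

(** * Energy increment between two states *)

Lemma mean_value_between {R : realType} {G : R -> R} (x y : R) :
  (forall x, derivable G x 1) ->
  exists2 c, `|c - x| <= `|y - x| & G y - G x = G^`()%classic c * (y - x).
Proof.
move=> dG.
have mvt a b : a <= b ->
    exists2 c, a <= c <= b & G b - G a = G^`()%classic c * (b - a).
  move=> ab; have [||c] := @MVT_segment R G G^`()%classic a b ab.
  - by move=> z _; rewrite derive1E; apply: DeriveDef.
  - apply: derivable_within_continuous => z _; exact: dG.
  - by rewrite in_itv /=; exists c.
have [xy|yx] := leP x y.
  have [c /andP[xc cy] Gc] := mvt _ _ xy; exists c => //.
  by rewrite !ger0_norm ?subr_ge0// lerD2r.
have [c /andP[yc cx] Gc] := mvt _ _ (ltW yx); exists c.
  by rewrite !ler0_norm ?subr_le0 ?(ltW yx)// !opprB lerD2l lerN2.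
by rewrite -opprB Gc -mulrN opprB.
Qed.

(** Replacing [g c] by [g x] at the mean value point costs at most [l * |y - x|]. The resulting
    constant [l], rather than the [l / 2] of an integral remainder, is what [2 * l <= kappa]
    matches. *)
Lemma lipschitz_descent {R : realType} {G g : R -> R} {l : R} (x y : R) :
  (forall x, derivable G x 1) -> (forall x, g x = - G^`()%classic x) ->
  l.-lipschitz g ->
  G y - G x <= - g x * (y - x) + l * (y - x) ^+ 2.
Proof.
move=> dG gE lip; have [c cx ->] := mean_value_between x y dG.
have -> : G^`()%classic c = - g c by rewrite gE opprK.
have lipc : `|g c - g x| <= l * `|c - x| by have := lip (c, x); apply.
(* The Lipschitz bound between [1] and [0] reads [|g 1 - g 0| <= l]. *)
have l0 : 0 <= l.
  have := lip (1, 0) (conj I I); rewrite /= subr0 normr1 mulr1.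
  exact: le_trans.
suff : (g x - g c) * (y - x) <= l * (y - x) ^+ 2 by lra.
apply: le_trans (ler_norm _) _; rewrite normrM -real_normK ?num_real// expr2 mulrA.
by rewrite ler_wpM2r// distrC (le_trans lipc)// ler_wpM2l.
Qed.

(** The terms [kappa *: u] of [stabg] and [stabL] cancel, and the quadratic term in [stabL] leaves
    [kappa / 2 * dotv d d], which dominates the remainder [l * dotv d d]. *)
Lemma energy_diff_le {R : realType} {n : nat} {L : 'M[R]_n} {G g : R -> R}
    {l kappa : R} (u w : 'cV[R]_n) :
  L^T = L -> (forall x, derivable G x 1) ->
  (forall x, g x = - G^`()%classic x) -> l.-lipschitz g -> 2 * l <= kappa ->
  energy L G w - energy L G u <=
    - dotv (w - u) (stabg kappa g u - stabL kappa L *m u)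
    + 2^-1 * dotv (w - u) (stabL kappa L *m (w - u)).
Proof.
move=> sL dG gE lip hk; set d := w - u.
have -> : w = u + d by rewrite addrC subrK. clearbody d.
have Gdiff : dotv (map_mx G (u + d)) (const_mx 1) - dotv (map_mx G u) (const_mx 1)
    <= - dotv d (map_mx g u) + kappa / 2 * dotv d d.
  rewrite !dotvE -sumrN mulr_sumr -sumrN -!big_split /=; apply: ler_sum => i _.
  rewrite !mxE !mulr1.
  apply: le_trans (lipschitz_descent _ _ dG gE lip) _.
  have -> : u i 0 + d i 0 - u i 0 = d i 0 by ring.
  have := sqr_ge0 (d i 0); nra.
rewrite /energy /stabg /stabL mulmxDl mulmxDl !mul_scalar_mx mulmxDr.
rewrite !(dotvDr, dotvNr, dotvZr, dotvDl) (dotv_sym u d sL).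
move: Gdiff; lra.
Qed.

(** A scheme enters only through [B]; once the residual is replaced by [tau^-1 *: (B *m d)], with
    [d = w - u], the two upper bounds coincide. *)
Lemma energy_step_le {R : realType} {n : nat} {L : 'M[R]_n} {G g : R -> R}
    {l kappa tau : R} (B : 'M[R]_n) (u w : 'cV[R]_n) :
  L^T = L -> (forall x, derivable G x 1) ->
  (forall x, g x = - G^`()%classic x) -> l.-lipschitz g -> 2 * l <= kappa ->
  0 < tau ->
  tau *: (stabg kappa g u - stabL kappa L *m u) = B *m (w - u) ->
  energy L G w - energy L G u <=
    - tau^-1 * dotv (w - u) ((B - 2^-1 *: (tau *: stabL kappa L)) *m (w - u)).
Proof.
move=> sL dG gE lip hk t0 BE.
apply: le_trans (energy_diff_le u w sL dG gE lip hk) _.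
rewrite mulmxBl -BE -!scalemxAl !(dotvDr, dotvNr, dotvZr) le_eqVlt; apply/orP; left.
by apply/eqP; field; rewrite gt_eqF.
Qed.

Theorem theorem2p2 (R : realType) (M : nat) (L : 'M[R]_M) (G g : R -> R)
    (lg kappa tau : R)
    (hL : spdmx L)
    (hG0 : forall x, 0 <= G x)
    (hGd : forall x, derivable G x 1)
    (hg : forall x, g x = - G^`()%classic x)
    (hlg : 0 < lg)
    (hLip : lg.-lipschitz g)
    (hkappa : 2 * lg <= kappa)
    (htau : 0 < tau) :
  (forall u : nat -> 'cV[R]_M,
     (forall n, (1 <= n)%N -> u n = tif1_step tau kappa L g (u n.-1)) ->
     forall n, (1 <= n)%N ->
       let du := u n - u n.-1 in
       energy L G (u n) - energy L G (u n.-1)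
       <= - tau^-1 * dotv du (mxfun (@DT1 R) (- (tau *: stabL kappa L)) *m du))
  /\
  (forall u : nat -> 'cV[R]_M,
     (forall n, (1 <= n)%N -> u n = nif1_step tau kappa L g (u n.-1)) ->
     forall n, (1 <= n)%N ->
       let du := u n - u n.-1 in
       energy L G (u n) - energy L G (u n.-1)
       <= - tau^-1 * dotv du (mxfun (@DN1 R) (- (tau *: stabL kappa L)) *m du)).
Proof.
case: hL => sL posL.
set Lk := stabL kappa L; pose A := tau *: Lk.
have sZ : (- A)^T = - A.
  by rewrite linearN linearZ /= /Lk /stabL linearD /= sL tr_scalar_mx.
have posA (v : 'cV[R]_M) : v != 0 -> 0 < dotv v (A *m v).
  move=> v0; rewrite /A /Lk /stabL -scalemxAl mulmxDl mul_scalar_mx.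
  rewrite dotvZr dotvDr dotvZr mulr_gt0// ltr_wpDr ?posL// mulr_ge0 ?dotv_ge0//.
  lra.
have negZ (v : 'cV[R]_M) : v != 0 -> dotv v (- A *m v) < 0.
  by move=> v0; rewrite mulNmx dotvNr oppr_lt0 posA.
split=> u hu n n1 /=; rewrite -/A; move: (hu n n1); clear hu.
(* The estimate concerns a single step, so consecutive iterates become arbitrary vectors. *)
all: move: (u n) (u n.-1) => w v; clear u; set d := w - v.
- rewrite /tif1_step -/Lk -/A => wE.
  have unitA : 1%:M + A \in unitmx.
    apply: posdef_unitmx => x x0.
    by rewrite mulmxDl mul1mx dotvDr ltr_wpDl ?posA ?dotv_ge0.
  have -> : mxfun (@DT1 R) (- A) = 1%:M + A - 2^-1 *: A.
    (* Writing [DT1] as a constant plus a multiple of the identity gives [1 + A / 2], that is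
       [B - A / 2] with [B = 1 + A]. *)
    transitivity (mxfun (fun x => 1 + - 2^-1 * x) (- A)).
      by apply: eq_mxfun_neg => // x _; rewrite /DT1; field.
    rewrite -mxfunD// mxfun_cst// -mxfunZ// mxfun_id// scalerN scaleNr opprK.
    rewrite -addrA; congr (_ + _).
    by rewrite -[X in _ = X - _]scale1r -scalerBl; congr (_ *: _); field.
  apply: (energy_step_le _ _ _ sL hGd hg hLip hkappa htau).
  rewrite -/Lk /d mulmxBr wE mulmxDr -scalemxAr !mulmxA mulmxV// !mul1mx.
  rewrite [(_ + A) *m v]mulmxDl mul1mx scalerBr scalemxAl -/A.
  by rewrite opprD addrACA subrr add0r.
- rewrite /nif1_step -/Lk -/A -scalerBr => wE.
  set r := tau *: _ in wE.
  have unitA : A \in unitmx by exact: posdef_unitmx.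
  (* [K] stands for the inverse of [e^Z - I] with [Z = - A]; it is a true inverse because
     [expR x - 1] vanishes at no [x < 0]. *)
  pose K := mxfun (fun x => (expR x - 1)^-1) (- A).
  have expN (x : R) : x < 0 -> expR x - 1 != 0.
    by move=> x0; rewrite subr_eq0 lt_eqF// expR_lt1.
  have KE : K *m (1%:M - mxfun expR (- A)) = - 1%:M.
    rewrite -[1%:M - _]opprB mulmxN; congr (- _).
    have -> : mxfun expR (- A) - 1%:M = mxfun (fun x => expR x - 1) (- A).
      by rewrite -mxfunD// mxfun_cst// raddfN.
    rewrite mxfunM// -(mxfun_cst 1 sZ).
    by apply: eq_mxfun_neg => // x /expN x0; rewrite mulVf.
  (* The scheme says [d = A^-1 (I - e^Z) r]. Here [- A] cancels [A^-1] up to a sign, and [KE]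
     supplies the second sign. *)
  have rE : r = K *m (- A) *m d.
    rewrite /d wE [v + _]addrC addrK !mulmxA mulmxN !mulNmx mulmxK// KE.
    by rewrite mulNmx mul1mx opprK.
  have -> : mxfun (@DN1 R) (- A) = K *m (- A) - 2^-1 *: A.
    (* The term [- A / 2] is the summand [z / 2] of [DN1] at [z = - A]. *)
    transitivity (K *m mxfun id (- A) + 2^-1 *: mxfun id (- A)); last first.
      by rewrite mxfun_id// scalerN.
    rewrite mxfunM// mxfunZ// mxfunD//.
    by apply: eq_mxfun_neg => // x _; rewrite /DN1 [x / 2]mulrC [x / _]mulrC.
  exact: (energy_step_le _ _ _ sL hGd hg hLip hkappa htau).
Qed.
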